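(* Let $p\geqslant 1$, let $K=(k_1,\dots,k_p)$ be a tuple with entries in $\mathbb{N}_{\geqslant 2}\cup\{\infty\}$, let $K'=(k'_1,\dots,k'_p)$ be a tuple of positive integers with $k'_i$ dividing $k_i$ for all $i$, and assume that the generalized $J$-group $J\binom{K}{K'}$ is nontrivial. Exactly one of the following three cases holds: (1) the group $J(K)$ is finite; (2) $J(K)$ is infinite and $J\binom{K}{K'}$ has finite index in $J(K)$; (3) $J\binom{K}{K'}$ has infinite index in $J(K)$. Moreover: \begin{itemize} \item $J\binom{K}{K'}$ is finite if and only if case (1) holds. \item $J\binom{K}{K'}$ is infinite and finitely generated if and only if case (2) holds. \item $J\binom{K}{K'}$ is not finitely generated if and only if case (3) holds. \end{itemize}
   Context: For a tuple $K=(k_1,\dots,k_p)$ with entries in $\mathbb{N}_{\geqslant 2}\cup\{\infty\}$, the generalized parent $J$-group $J(K)$ is the group with presentation $\langle s_1,\dots,s_p\mid s_1s_2\cdots s_p=s_2\cdots s_ps_1=\cdots=s_ps_1\cdots s_{p-1},\ s_i^{k_i}=1 \text{ for all } i \text{ with } k_i<\infty\rangle$. By convention every positive integer divides $\infty$. The generalized $J$-group $J\binom{K}{K'}$ is the normal closure of $\{s_1^{k'_1},\dots,s_p^{k'_p}\}$ in $J(K)$. *)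

(* Defs.v *)
From HB Require Import structures.
From mathcomp Require Import all_boot.
From mathcomp Require Import boolp classical_sets cardinality.
Set Implicit Arguments.
Unset Strict Implicit.
Unset Printing Implicit Defensive.

Local Open Scope classical_set_scope.
Local Open Scope group_scope.
Local Open Scope quotient_scope.

Section Presentation.
Variable I : choiceType.

(* A letter (i, false) is the generator i, and (i, true) is its inverse. *)
Definition word : Type := seq (I * bool).

Definition winv (w : word) : word := rev [seq (a.1, ~~ a.2) | a <- w].

(* A relation u = v between words is given as the pair (u, v). *)
Variable rels : set (word * word).

Inductive word_eq : word -> word -> Prop :=
| word_eq_refl u : word_eq u u
| word_eq_sym u v : word_eq u v -> word_eq v u
| word_eq_trans v u w : word_eq u v -> word_eq v w -> word_eq u w
| word_eq_cat u u' v v' :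
    word_eq u u' -> word_eq v v' -> word_eq (u ++ v) (u' ++ v')
| word_eq_cancel i b : word_eq [:: (i, b); (i, ~~ b)] [::]
| word_eq_rel u v : rels (u, v) -> word_eq u v.

Definition word_eqb : rel word := fun u v => `[< word_eq u v >].

Lemma word_eqb_refl : reflexive word_eqb.
Proof. by move=> u; apply/asboolP; exact: word_eq_refl. Qed.

Lemma word_eqb_sym : symmetric word_eqb.
Proof. by move=> u v; apply/asboolP/asboolP; exact: word_eq_sym. Qed.

Lemma word_eqb_trans : transitive word_eqb.
Proof.
by move=> v u w /asboolP uv /asboolP vw; apply/asboolP/(word_eq_trans uv vw).
Qed.

Canonical word_equiv :=
  EquivRel word_eqb word_eqb_refl word_eqb_sym word_eqb_trans.

Definition presented := {eq_quot word_equiv}.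

HB.instance Definition _ := EqQuotient.on presented.
HB.instance Definition _ := Choice.on presented.

Definition pres_class (u : word) : presented := \pi_presented u.

Lemma pres_classP u v : pres_class u = pres_class v <-> word_eq u v.
Proof.
by split=> [/eqmodP/asboolP//|uv]; apply/eqmodP/asboolP.
Qed.

Lemma pres_repr (x : presented) : pres_class (repr x) = x.
Proof. exact: reprK. Qed.

Lemma repr_pres_class u : word_eq (repr (pres_class u)) u.
Proof. by apply/pres_classP; rewrite pres_repr. Qed.

Lemma word_eq_mulVw u : word_eq (winv u ++ u) [::].
Proof.
elim: u => [|[i b] u IHu]; first exact: word_eq_refl.
rewrite /winv /= rev_cons cat_rcons -/(winv u).
apply: (@word_eq_trans (winv u ++ u)) => //.
apply: word_eq_cat; first exact: word_eq_refl.
rewrite -[(i, ~~ b) :: _]/([:: (i, ~~ b); (i, b)] ++ u).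
apply: (@word_eq_trans ([::] ++ u)); last exact: word_eq_refl.
apply: word_eq_cat; last exact: word_eq_refl.
by rewrite -{2}[b]negbK; exact: word_eq_cancel.
Qed.

Lemma winvK : involutive winv.
Proof.
move=> u; rewrite /winv map_rev revK -map_comp -[RHS]map_id.
by apply: eq_map => -[i b] /=; rewrite negbK.
Qed.

Lemma word_eq_mulwV u : word_eq (u ++ winv u) [::].
Proof. by rewrite -{1}[u]winvK; exact: word_eq_mulVw. Qed.

Definition pres_mul (x y : presented) := pres_class (repr x ++ repr y).
Definition pres_one := pres_class [::].
Definition pres_inv (x : presented) := pres_class (winv (repr x)).

Lemma pres_mulA : associative pres_mul.
Proof.
move=> x y z; apply/pres_classP.
apply: (@word_eq_trans (repr x ++ (repr y ++ repr z))).
  by apply: word_eq_cat; [exact: word_eq_refl | exact: repr_pres_class].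
rewrite catA; apply: word_eq_sym.
by apply: word_eq_cat; [exact: repr_pres_class | exact: word_eq_refl].
Qed.

Lemma pres_mul1 : left_id pres_one pres_mul.
Proof.
move=> x; rewrite -[RHS]pres_repr; apply/pres_classP.
rewrite -[X in word_eq _ X]cat0s.
by apply: word_eq_cat; [exact: repr_pres_class | exact: word_eq_refl].
Qed.

Lemma pres_1mul : right_id pres_one pres_mul.
Proof.
move=> x; rewrite -[RHS]pres_repr; apply/pres_classP.
rewrite -[X in word_eq _ X]cats0.
by apply: word_eq_cat; [exact: word_eq_refl | exact: repr_pres_class].
Qed.

Lemma pres_mulV : left_inverse pres_one pres_inv pres_mul.
Proof.
move=> x; apply/pres_classP; apply: word_eq_trans (word_eq_mulVw (repr x)).
by apply: word_eq_cat; [exact: repr_pres_class | exact: word_eq_refl].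
Qed.

Lemma pres_Vmul : right_inverse pres_one pres_inv pres_mul.
Proof.
move=> x; apply/pres_classP; apply: word_eq_trans (word_eq_mulwV (repr x)).
by apply: word_eq_cat; [exact: word_eq_refl | exact: repr_pres_class].
Qed.

HB.instance Definition _ := isGroup.Build presented
  pres_mulA pres_mul1 pres_1mul pres_mulV pres_Vmul.

Definition pres_gen (i : I) : presented := pres_class [:: (i, false)].

Lemma pres_classM u v : pres_class (u ++ v) = pres_class u * pres_class v.
Proof.
apply/pres_classP/word_eq_sym.
by apply: word_eq_cat; exact: repr_pres_class.
Qed.

Lemma pres_class_letter i b :
  pres_class [:: (i, b)] = if b then (pres_gen i)^-1 else pres_gen i.
Proof.
case: b => //; apply/esym/mulg1_eq; rewrite -pres_classM.
by apply/pres_classP; exact: word_eq_cancel.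
Qed.

Definition word_val (G : groupType) (f : I -> G) (w : word) : G :=
  \prod_(a <- w) (if a.2 then (f a.1)^-1 else f a.1).

Lemma pres_classE u : pres_class u = word_val pres_gen u.
Proof.
rewrite /word_val; elim: u => [|[i b] u IHu]; first by rewrite big_nil.
by rewrite big_cons -IHu -cat1s pres_classM pres_class_letter.
Qed.

Lemma presentedP (G : groupType) (f : I -> G) :
  (forall u v, rels (u, v) -> word_val f u = word_val f v) ->
  exists! h : presented -> G,
    {morph h : x y / x * y} /\ forall i, h (pres_gen i) = f i.
Proof.
move=> frel.
have fE u v : word_eq u v -> word_val f u = word_val f v.
  elim=> {u v} //; last 1 first.
  - by move=> i b; rewrite /word_val !big_cons big_nil; case: b => /=;
      rewrite mulg1 ?mulVg ?mulgV.
  - by move=> v u w _ -> _ ->.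
  - by move=> u u' v v' _ uu' _ vv';
      rewrite /word_val !big_cat /= -!/(word_val _ _) uu' vv'.
have clE u : word_val f (repr (pres_class u)) = word_val f u.
  exact/fE/repr_pres_class.
exists (fun x => word_val f (repr x)); split=> [|h [hM hg]].
  split=> [x y|i]; last by rewrite clE /word_val big_seq1.
  by rewrite clE /word_val big_cat.
have h1 : h 1 = 1 by apply: (mulIg (h 1)); rewrite -hM !mul1g.
apply/funext => x; rewrite -[in RHS](pres_repr x).
elim: (repr x) => [|[i b] u IHu]; first by rewrite /word_val big_nil; apply/esym.
rewrite -cat1s pres_classM hM -IHu /word_val big_cat big_seq1 /=.
congr (_ * _); rewrite pres_class_letter; case: b; last by rewrite hg.
by apply: mulg1_eq; rewrite -hg -hM mulgV h1.
Qed.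

End Presentation.

Section Subgroups.
Variable G : groupType.
Implicit Types A H : set G.

Definition subgroup H := group_closed (mem H).

Definition normal_subgroup H :=
  subgroup H /\ forall x y, H x -> H (x ^ y).

Definition generated A : set G := smallest subgroup A.

Definition normal_closure A : set G := smallest normal_subgroup A.

Definition finitely_generated H := exists2 A, finite_set A & generated A = H.

Definition left_coset H (x : G) : set G := [set x * h | h in H].

Definition finite_index H := finite_set (range (left_coset H)).

End Subgroups.

Definition exactly_one_of_three (P Q R : Prop) :=
  (P \/ Q \/ R) /\ ~ (P /\ Q) /\ ~ (P /\ R) /\ ~ (Q /\ R).

(* None stands for infinity, which every positive integer divides. *)
Definition divides_ext (d : nat) (k : option nat) :=
  if k is Some m then (d %| m)%N else true.

Section JGroups.
Variable p : nat.

Variable K : p.-tuple (option nat).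

Definition full_word : word 'I_p := [seq (i, false) | i <- enum 'I_p].

Definition J_rels : set (word 'I_p * word 'I_p) :=
  [set r | (exists i : 'I_p, r = (full_word, rot i full_word)) \/
           (exists (i : 'I_p) (k : nat), tnth K i = Some k /\
                                         r = (nseq k (i, false), [::]))].

Definition parent_J : groupType := presented J_rels.

Definition J_gen (i : 'I_p) : parent_J := pres_gen J_rels i.

Definition generalized_J (K' : p.-tuple nat) : set parent_J :=
  normal_closure (range (fun i : 'I_p => J_gen i ^+ tnth K' i)).

End JGroups.

Arguments generalized_J {p} K K' _.

(* Main.v *)
From HB Require Import structures.
Require Import Defs.
From mathcomp Require Import all_boot all_algebra.
From mathcomp Require Import boolp classical_sets cardinality.

(** Write [G] for the parent group, [c = s_1 ... s_p], [N] for the normal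
    closure of the powers [s_i ^+ k'_i], and [H = N <c>]. The presentation says
    exactly that [c] is central and that [s_i ^+ k_i = 1] for finite [k_i].

    The three cases exclude one another and exhaust the possibilities by their
    very form, and when [N] has finite index the remaining claims are general:
    [N] is finitely generated ([schreier]) and is finite only if [G] is. All the
    content is that [N], if it is nontrivial and of infinite index, is not
    finitely generated ([generalized_J_not_finitely_generated]).

    First, [H] also has infinite index ([central_product_finite_index]).
    Otherwise [G / N] is a central extension of a finite group by [<c>]; the
    transfer to [<c>] kills the generators, which are torsion in [G / N], and
    sends [c] to a positive power of itself, so [c] is torsion too and [G / N]
    is finite.

    Next, pick [s = s_i0] with [s ^+ k' <> 1]. A crossed homomorphism [d] from
    [G] to the [H]-invariant functions from [G] to a finite ring restricts to an
    additive map on [N]. If [N] is finitely generated then [d N] is finite, and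
    it is stable under the translations of [G], since [N] is normal. So [d]
    cannot take on [N] a nonzero value that is supported on finitely many cosets
    of [H]: its translates would cover [G / H]
    ([crossed_hom_not_finitely_generated]).

    Such a [d] is obtained by deforming the generators inside a wreath product
    of [G] ([J_crossed_hom]). Conjugate one generator [s_i], with [i] different
    from [i0], by the indicator function of [H], keep the others, and let [s_i0]
    absorb the change so that the product stays equal to [c]. The relations [s_j
    ^+ k_j = 1] with [j] different from [i0] visibly persist. The value of [d]
    at [s] becomes a difference of indicators of two cosets of [H]. Summed over
    [k'] consecutive points of a cycle of right translation by [s], either
    indicator gives 0 or a fixed number [e], the number of [l < k'] with [s ^+
    l] in [H]. With coefficients modulo [(k_i0 / k') * e], or [2 * e] if [k_i0]
    is infinite, the relation on the order of [s] therefore persists, while [d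
    (s ^+ k')] takes the nonzero value [- e] somewhere, provided that the two
    cosets lie on different cycles. This can be arranged by the choice of [i],
    because [H <s>] is not all of [G], the index of [H] being infinite
    ([J_not_finitely_generated]). *)

Set Implicit Arguments.
Unset Strict Implicit.
Unset Printing Implicit Defensive.

Import GRing.Theory Num.Theory.

Local Open Scope classical_set_scope.
Local Open Scope group_scope.

(** * Subgroups and cosets in groups that may be infinite *)

Section SubgroupTheory.
Variable G : groupType.
Implicit Types (A H N : set G) (x y : G).

Lemma subgroupP H :
  subgroup H <-> H 1 /\ forall x y, H x -> H y -> H (x / y).
Proof.
split=> [[H1 Hdiv]|[H1 Hdiv]]; split.
- by rewrite -in_setE.
- by move=> x y /mem_set Hx /mem_set Hy; apply/set_mem/Hdiv.
- exact/mem_set.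
- by move=> x y /set_mem Hx /set_mem Hy; apply/mem_set/Hdiv.
Qed.

Lemma subgroup1 H : subgroup H -> H 1.
Proof. by move=> /subgroupP[]. Qed.

Lemma subgroupV H x : subgroup H -> H x -> H x^-1.
Proof. by move=> /subgroupP[H1 Hdiv] Hx; rewrite -div1g; exact: Hdiv. Qed.

Lemma subgroupM H x y : subgroup H -> H x -> H y -> H (x * y).
Proof.
move=> sH Hx Hy; have [_ Hdiv] := (subgroupP H).1 sH.
by rewrite -[y]invgK; apply: Hdiv => //; apply: subgroupV.
Qed.

Lemma subgroupX H x n : subgroup H -> H x -> H (x ^+ n).
Proof.
move=> sH Hx; elim: n => [|n IHn]; first exact: subgroup1.
by rewrite expgS; exact: subgroupM.
Qed.

Lemma subgroup_mulr H x y : subgroup H -> H x -> H (y * x) <-> H y.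
Proof.
move=> sH Hx; split=> [Hyx|Hy]; last exact: subgroupM.
by rewrite -[y](mulgK x); apply: subgroupM => //; exact: subgroupV.
Qed.

Lemma subgroup_mull H x y : subgroup H -> H x -> H (x * y) <-> H y.
Proof.
move=> sH Hx; split=> [Hxy|Hy]; last exact: subgroupM.
by rewrite -[y](mulKg x); apply: subgroupM => //; exact: subgroupV.
Qed.

Lemma subgroup_generated A : subgroup (generated A).
Proof.
apply/subgroupP; split=> [H [sH _]|x y gx gy H HA]; first exact: subgroup1.
by have [_] := (subgroupP H).1 HA.1; apply; [exact: gx | exact: gy].
Qed.

Lemma sub_generated A : A `<=` generated A.
Proof. exact: sub_gen_smallest. Qed.

Lemma generated_sub A H : subgroup H -> A `<=` H -> generated A `<=` H.
Proof. exact: smallest_sub. Qed.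

Lemma normal_normal_closure A : normal_subgroup (normal_closure A).
Proof.
split; last by move=> x y nx H HA; apply: HA.1.2; exact: nx.
apply/subgroupP; split=> [H [[sH _] _]|x y gx gy H HA].
  exact: subgroup1.
by have [_] := (subgroupP H).1 HA.1.1; apply; [exact: gx | exact: gy].
Qed.

Lemma normal_subgroup_conj N x y :
  normal_subgroup N -> N (y * x * y^-1) <-> N x.
Proof.
move=> [_ nN]; have -> : y * x * y^-1 = x ^ y^-1 by rewrite conjgE invgK mulgA.
by split=> [/(nN _ y)|/nN//]; rewrite conjgKV.
Qed.

Lemma normal_subgroup_comm N x y : normal_subgroup N -> N (x * y) <-> N (y * x).
Proof.
by move=> nN; rewrite -(normal_subgroup_conj (x * y) y nN) mulgA mulgK.
Qed.

(** Relative smallness: finite index is the case [A = setT], and arguments by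
    covering need the notion for parts of the group as well. *)
Definition coset_bounded H A :=
  exists s : seq G, forall x, A x -> exists2 y, y \in s & H (y^-1 * x).

Lemma left_coset_eq H x y :
  subgroup H -> left_coset H x = left_coset H y <-> H (y^-1 * x).
Proof.
move=> sH; split=> [Exy|Hyx].
  have: left_coset H x x by exists 1; rewrite ?mulg1//; exact: subgroup1.
  by rewrite Exy => -[h Hh <-]; rewrite mulKg.
apply/seteqP; split=> _ [h Hh <-]; rewrite /left_coset /=.
  by exists (y^-1 * x * h); [exact: subgroupM | rewrite -mulgA mulVKg].
exists ((y^-1 * x)^-1 * h); first by apply: subgroupM => //; exact: subgroupV.
by rewrite invgM invgK mulgA mulgA mulgV mul1g.
Qed.

Lemma finite_index_bounded H :
  subgroup H -> finite_index H <-> coset_bounded H setT.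
Proof.
move=> sH; split=> [/finite_seqP[s Es]|[s sP]].
  have rep (A : set G) : exists x, A \in s -> left_coset H x = A.
    have [As|nAs] := pselect (A \in s); last by exists 1.
    by have: [set` s] A by []; rewrite -Es => -[x _ <-]; exists x.
  have [r rP] := choice rep.
  exists (map r s) => x _; have xs : left_coset H x \in s.
    by suff: [set` s] (left_coset H x) by []; rewrite -Es; exists x.
  exists (r (left_coset H x)); first exact: map_f.
  by apply/left_coset_eq => //; rewrite rP.
apply: sub_finite_set (finite_image (left_coset H) (finite_seq s)).
move=> _ [x _ <-]; have [//|y ys Hyx] := sP x.
by exists y => //; apply/esym/left_coset_eq.
Qed.

Lemma coset_bounded_cover (I : eqType) (s : seq I) (F : I -> set G) H A :
  (forall i, i \in s -> coset_bounded H (F i)) ->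
  (forall x, A x -> exists2 i, i \in s & F i x) -> coset_bounded H A.
Proof.
elim: s A => [|i s IHs] A bF cF.
  by exists [::] => x /cF[].
have [t tP] : coset_bounded H (F i) by apply: bF; rewrite mem_head.
have [u uP] : coset_bounded H (A `\` F i).
  apply: IHs => [j js|x [Ax nFx]].
    by apply: bF; rewrite inE js orbT.
  have [j] := cF x Ax; rewrite inE => /orP[/eqP->//|js Fx].
  by exists j.
exists (t ++ u) => x Ax; have [Fx|nFx] := pselect (F i x).
  by have [y yt Hy] := tP x Fx; exists y; rewrite // mem_cat yt.
have [//|y yu Hy] := uP x; exists y => //.
by rewrite mem_cat yu orbT.
Qed.

Lemma finite_index_transversal H : subgroup H -> finite_index H ->
  exists (I : finType) (t : I -> G) (c : G -> I),
    cancel t c /\ forall x y, c x = c y <-> H (y^-1 * x).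
Proof.
move=> sH /finite_seqP[s Es].
have cs x : left_coset H x \in s.
  by suff: [set` s] (left_coset H x) by []; rewrite -Es; exists x.
pose c x : seq_sub s := SeqSub (cs x).
have rep (i : seq_sub s) : exists x, c x = i.
  have: [set` s] (ssval i) by exact: ssvalP.
  by rewrite -Es => -[x _ xi]; exists x; apply/val_inj.
have [t tP] := choice rep.
exists (seq_sub s), t, c; split=> // x y.
rewrite -left_coset_eq//; split=> [[]//|xy].
exact/val_inj.
Qed.

End SubgroupTheory.

(** If [s] contains [1] and represents the cosets of [H], the elements
    [y^-1 * z * x] of [H], with [x], [y] in [s] and [z] a generator, its inverse
    or [1], generate a subgroup [B] such that the products of [s] and [B] are
    stable under left multiplication by the generators, hence are everything. *)
Lemma schreier (G : groupType) (S H : set G) :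
  finite_set S -> generated S = setT -> subgroup H -> finite_index H ->
  finitely_generated H.
Proof.
move=> fS gS sH /(finite_index_bounded sH)[s0 s0P].
pose s := 1 :: s0.
have sP x : exists2 y, y \in s & H (y^-1 * x).
  by have [//|y ys Hy] := s0P x; exists y => //; rewrite inE ys orbT.
pose B := [set b | H b /\ exists x y z,
  [/\ x \in s, y \in s, S z \/ S z^-1 \/ z = 1 & b = y^-1 * z * x]].
have sB := subgroup_generated B.
exists B.
  pose Z := S `|` (fun z => z^-1) @` S `|` [set 1].
  have fZ : finite_set Z.
    by rewrite !finite_setU; split=> //; split=> //; exact: finite_image.
  have fsZ := finite_setX (finite_setX (finite_seq s) (finite_seq s)) fZ.
  apply: sub_finite_set (finite_image (fun a => a.1.2^-1 * a.2 * a.1.1) fsZ).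
  move=> b [_ [x [y [z [xs ys Sz ->]]]]].
  exists ((x, y), z) => //; split=> //=; case: Sz => [|[Sz|->]].
  - by left; left.
  - by left; right; exists z^-1; rewrite ?invgK.
  - by right.
apply/seteqP; split=> [|h Hh]; first by apply: generated_sub => // b [].
pose T := [set g | exists2 x, x \in s & generated B (x^-1 * g)].
have TS z g : S z \/ S z^-1 \/ z = 1 -> T g -> T (z * g).
  move=> Sz [x xs Bg]; have [y ys Hy] := sP (z * x).
  exists y => //; have -> : y^-1 * (z * g) = (y^-1 * z * x) * (x^-1 * g).
    by rewrite -!mulgA mulVKg.
  apply: (subgroupM sB) => //; apply: sub_generated; split; first by rewrite -mulgA.
  by exists x, y, z.
have T1 : T 1 by exists 1; rewrite ?mem_head// mulg1 invg1; exact: subgroup1.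
pose P := [set z | forall g, T g -> T (z * g) /\ T (z^-1 * g)].
have PT : generated S `<=` P.
  apply: generated_sub => [|z Sz g Tg].
    apply/subgroupP; split=> [g Tg|x y Px Py g Tg].
      by rewrite invg1 mul1g.
    rewrite invgF -!mulgA; split; first by apply: (Px _ _).1; apply: (Py _ _).2.
    by apply: (Py _ _).1; apply: (Px _ _).2.
  by split; apply: TS => //; rewrite ?invgK; [left | right; left].
have [x xs Bh] : T h.
  by rewrite -[h]mulg1; apply: (PT h _ 1 T1).1; rewrite gS.
have Hx : H x.
  have Hxh : H (x^-1 * h).
    by apply: (generated_sub sH _ Bh) => b [].
  by have := (subgroup_mulr x^-1 sH Hh).1 Hxh; move/(subgroupV sH); rewrite invgK.
rewrite -[h](mulVKg x); apply: (subgroupM sB) => //.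
apply: sub_generated; split=> //.
by exists x, 1, 1; rewrite mem_head invg1 !mul1g; split=> //; do 2!right.
Qed.

(** * Extensions by a central cyclic group *)

Section CentralExtension.
Variables (G : groupType) (N S : set G) (c : G).
Hypothesis nN : normal_subgroup N.
Hypothesis cC : forall x, commute c x.

(** The congruence of [x] modulo [N] with the power of [c] of exponent [z];
    differences of natural numbers stand for integer exponents. *)
Definition pow_mod x (z : int) :=
  exists m n : nat, z = (n%:Z - m%:Z)%R /\
    exists2 a, N a & x * c ^+ m = a * c ^+ n.

Definition central_product := [set x | exists z, pow_mod x z].

Let sN : subgroup N := nN.1.

Let cXC n x : x * c ^+ n = c ^+ n * x.
Proof. by apply/commuteX/commute_sym. Qed.

Lemma pow_mod_in x : N x -> pow_mod x 0.
Proof. by move=> Nx; exists 0%N, 0%N; rewrite subrr; split=> //; exists x. Qed.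

Lemma pow_mod_base : pow_mod c 1.
Proof.
exists 0%N, 1%N; rewrite subr0; split=> //; exists 1; first exact: subgroup1.
by rewrite expg0 mulg1 mul1g.
Qed.

Lemma pow_modM x y z w :
  pow_mod x z -> pow_mod y w -> pow_mod (x * y) (z + w)%R.
Proof.
move=> [m [n [-> [a Na xE]]]] [m' [n' [-> [b Nb yE]]]].
exists (m + m')%N, (n + n')%N; split; first by rewrite !PoszD opprD addrACA.
exists (a * b); first exact: subgroupM.
have regroup u v k l : u * v * c ^+ (k + l) = u * c ^+ k * (v * c ^+ l).
  by rewrite expgnDr !mulgA -[u * v * _]mulgA (cXC k v) mulgA.
by rewrite !regroup xE yE.
Qed.

Lemma pow_modV x z : pow_mod x z -> pow_mod x^-1 (- z)%R.
Proof.
move=> [m [n [-> [a Na xE]]]]; exists n, m; rewrite opprB; split=> //.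
exists (x^-1 * a^-1 * x); last by rewrite -[_ * x * _]mulgA xE mulgA mulgVK.
rewrite -[X in _ * _ * X]invgK normal_subgroup_conj//; exact: subgroupV.
Qed.

Lemma subgroup_central_product : subgroup central_product.
Proof.
apply/subgroupP; split=> [|x y [z xz] [w yw]].
  by exists 0%R; apply: pow_mod_in; exact: subgroup1.
by exists (z - w)%R; apply: pow_modM => //; exact: pow_modV.
Qed.

Lemma normal_central_product : normal_subgroup central_product.
Proof.
split=> [|x y [z [m [n [zE [a Na xE]]]]]]; first exact: subgroup_central_product.
exists z, m, n; split=> //; exists (a ^ y); first exact: nN.2.
have cJ k : (c ^+ k) ^ y = c ^+ k by rewrite conjgE -cXC mulKg.
by rewrite -(cJ m) -(cJ n) -!conjMg xE.
Qed.

Lemma sub_central_product : N `<=` central_product.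
Proof. by move=> x Nx; exists 0%R; exact: pow_mod_in. Qed.

Lemma central_product_base : central_product c.
Proof. by exists 1%R; exact: pow_mod_base. Qed.

Lemma pow_mod_inj x z w : (forall n, (0 < n)%N -> ~ N (c ^+ n)) ->
  pow_mod x z -> pow_mod x w -> z = w.
Proof.
move=> cN [m [n [-> [a Na xa]]]] [m' [n' [-> [b Nb xb]]]].
have ab : a * c ^+ (n + m') = b * c ^+ (n' + m).
  by rewrite !expgnDr !mulgA -xa -xb -!mulgA -!expgnDr addnC.
have noN k l u v : N u -> N v -> u * c ^+ k = v * c ^+ l -> (k <= l)%N.
  move=> Nu Nv uv; rewrite leqNgt; apply/negP=> lk.
  apply: (cN (k - l)%N); first by rewrite subn_gt0.
  have -> : c ^+ (k - l) = u^-1 * v; last first.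
    by apply: subgroupM => //; exact: subgroupV.
  by apply: (mulIg (c ^+ l)); rewrite -expgnDr (subnK (ltnW lk)) -mulgA -uv mulKg.
have E : (n + m')%N = (n' + m)%N.
  by apply/anti_leq; rewrite (noN _ _ _ _ Na Nb ab) (noN _ _ _ _ Nb Na (esym ab)).
by apply/eqP; rewrite subr_eq addrAC eq_sym subr_eq -!PoszD E.
Qed.

(** If a positive power of [c] lies in [N], then [N] has finite index in
    [central_product], hence in [G]. Otherwise the exponents of [pow_mod] are
    unique and the transfer to the infinite cyclic group generated by [c]
    modulo [N] is an additive [zeta : G -> int]; it vanishes on torsion modulo
    [N], hence everywhere, although [zeta c] is the index of
    [central_product]. *)
Lemma central_product_finite_index : generated S = setT ->
  (forall s, S s -> exists2 k, (0 < k)%N & N (s ^+ k)) ->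
  finite_index central_product -> finite_index N.
Proof.
move=> gS Stors fH.
have sH := subgroup_central_product; have [_ nH] := normal_central_product.
have [[r r0 Nr]|cN] := pselect (exists2 r, (0 < r)%N & N (c ^+ r)).
  have [s sP] := (finite_index_bounded sH).1 fH.
  apply/finite_index_bounded => //.
  exists [seq y * c ^+ i | y <- s, i <- iota 0 r] => x _.
  have [//|y ys [z [m [n [_ [a Na E]]]]]] := sP x.
  (* modulo [N], the inverse of [c ^+ m] is [c ^+ (m * r.-1)] *)
  pose e := (n + m * r.-1)%N.
  exists (y * c ^+ (e %% r)).
    by apply: allpairs_f; rewrite ?mem_iota ?ltn_mod.
  have NX k : N (c ^+ (k * r)) by rewrite mulnC expgnA; exact: subgroupX.
  apply/(subgroup_mulr _ sN (NX m)).
  have -> : (y * c ^+ (e %% r))^-1 * x * c ^+ (m * r) =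
      a ^ (c ^+ (e %% r)) * c ^+ (e %/ r * r).
    rewrite conjgE invgM -!mulgA; congr (_ * _).
    rewrite -expgnDr [(_ %% _ + _)%N]addnC -divn_eq.
    by rewrite -(prednK r0) mulnS !expgnDr !mulgA -E -!mulgA.
  by apply: subgroupM => //; exact: nN.2.
have {}cN n : (0 < n)%N -> ~ N (c ^+ n) by move=> n0 Nn; apply: cN; exists n.
have [I [t [ind [tK indP]]]] := finite_index_transversal sH fH.
pose act g i := ind (g * t i).
have actP g i : central_product ((t (act g i))^-1 * (g * t i)).
  by apply/indP; rewrite tK.
have [z zP] := choice (fun gi : G * I => actP gi.1 gi.2).
pose zeta g : int := (\sum_i z (g, i))%R.
have actM g h i : act (g * h) i = act g (act h i).
  apply/indP; rewrite invgM -!mulgA mulKg; exact: actP.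
have zeta_eq g (f : I -> int) :
    (forall i, pow_mod ((t (act g i))^-1 * (g * t i)) (f i)) ->
  zeta g = (\sum_i f i)%R.
  by move=> fP; apply: eq_bigr => i _; exact: pow_mod_inj (zP (g, i)) (fP i).
have act_inj h : injective (act h).
  move=> i j /indP; rewrite invgM -mulgA mulKg => /indP.
  by rewrite !tK.
have zetaM g h : zeta (g * h) = (zeta g + zeta h)%R.
  rewrite /zeta [X in (X + _)%R](reindex_inj (@act_inj h)) -big_split/=.
  apply: zeta_eq => i; have := pow_modM (zP (g, act h i)) (zP (h, i)).
  by rewrite /= -actM -!mulgA mulVKg.
have zeta_fix g k : (forall i, pow_mod (g ^ t i) k) -> zeta g = (k *+ #|I|)%R.
  move=> gP; rewrite -sumr_const; apply: zeta_eq => i.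
  suff -> : act g i = i by rewrite -conjgE.
  by rewrite -[RHS]tK; apply/indP; rewrite -conjgE; exists k.
have zetaN g : N g -> zeta g = 0%R.
  move=> Ng; rewrite (@zeta_fix _ 0%R) ?mul0rn// => i.
  by apply: pow_mod_in; exact: nN.2.
have zetac : zeta c = (#|I|%:R)%R.
  apply: zeta_fix => i; rewrite conjgE (cC (t i)) mulKg; exact: pow_mod_base.
have zetaX g k : zeta (g ^+ k) = (zeta g *+ k)%R.
  elim: k => [|k IHk]; first by rewrite zetaN//; exact: subgroup1.
  by rewrite expgS zetaM IHk mulrS.
have zeta0 : generated S `<=` [set g | zeta g = 0%R].
  apply: generated_sub => [|s /Stors[k k0 /zetaN]]; last first.
    by rewrite zetaX => /eqP; rewrite mulrn_eq0 eqn0Ngt k0 => /eqP.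
  apply/subgroupP; split=> [|x y /= x0 y0]; first by apply: zetaN; exact: subgroup1.
  have := zetaM (x / y) y; by rewrite mulgVK x0 y0 addr0 => <-.
have /eqP : zeta c = 0%R by apply: zeta0; rewrite gS.
by rewrite zetac pnatr_eq0 => /eqP/card0_eq/(_ (ind 1)).
Qed.
End CentralExtension.

(** * Crossed homomorphisms as sections of a wreath product *)

Section Wreath.
Variables (G : groupType) (V : zmodType).

(** The unrestricted wreath product, [G] acting on functions by right
    translation of their argument. A morphism from [G] to [wreath G V] whose
    second component is the identity amounts to a crossed homomorphism from [G]
    to the functions on [G], so such crossed homomorphisms can be obtained from
    the universal property of a presentation. *)
Definition wreath : Type := ((G -> V) * G)%type.

HB.instance Definition _ := Choice.on wreath.

Implicit Types a b : wreath.

Definition wreath_mul a b : wreath :=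
  (fun x => (a.1 x + b.1 (x * a.2)%g)%R, a.2 * b.2).
Definition wreath_one : wreath := (fun=> 0%R, 1).
Definition wreath_inv a : wreath := (fun x => (- a.1 (x * a.2^-1)%g)%R, a.2^-1).

Fact wreath_mulA : associative wreath_mul.
Proof.
move=> a b c; congr pair; last exact: mulgA.
by apply/funext => x /=; rewrite addrA mulgA.
Qed.

Fact wreath_mul1 : left_id wreath_one wreath_mul.
Proof.
move=> [f g]; congr pair; last exact: mul1g.
by apply/funext => x /=; rewrite add0r mulg1.
Qed.

Fact wreath_1mul : right_id wreath_one wreath_mul.
Proof.
move=> [f g]; congr pair; last exact: mulg1.
by apply/funext => x /=; rewrite addr0.
Qed.

Fact wreath_mulV : left_inverse wreath_one wreath_inv wreath_mul.
Proof.
move=> [f g]; congr pair; last exact: mulVg.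
by apply/funext => x /=; rewrite addNr.
Qed.

Fact wreath_Vmul : right_inverse wreath_one wreath_inv wreath_mul.
Proof.
move=> [f g]; congr pair; last exact: mulgV.
by apply/funext => x /=; rewrite mulgK addrN.
Qed.

HB.instance Definition _ := isGroup.Build wreath
  wreath_mulA wreath_mul1 wreath_1mul wreath_mulV wreath_Vmul.

Lemma wreathM1 a b x : (a * b).1 x = (a.1 x + b.1 (x * a.2)%g)%R. Proof. by []. Qed.
Lemma wreathM2 a b : (a * b).2 = a.2 * b.2. Proof. by []. Qed.
Lemma wreathV1 a x : (a^-1).1 x = (- a.1 (x * a.2^-1)%g)%R. Proof. by []. Qed.
Lemma wreathV2 a : (a^-1).2 = a.2^-1. Proof. by []. Qed.

Lemma wreath_eq1 a : (forall x, a.1 x = 0%R) -> a.2 = 1 -> a = 1.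
Proof. by case: a => f g /= f0 ->; congr pair; apply/funext. Qed.

Lemma wreathX2 a n : (a ^+ n).2 = a.2 ^+ n.
Proof. by elim: n => // n IHn; rewrite !expgS wreathM2 IHn. Qed.

Lemma wreathX1 a n x : (a ^+ n).1 x = (\sum_(l < n) a.1 (x * a.2 ^+ l)%g)%R.
Proof.
elim: n x => [|n IHn] x; first by rewrite big_ord0.
rewrite expgS wreathM1 IHn big_ord_recl expg0 mulg1; congr (_ + _)%R.
by apply: eq_bigr => l _; rewrite -mulgA -expgS.
Qed.

Lemma wreath_prod2 (I : Type) (r : seq I) (F : I -> wreath) :
  (\prod_(i <- r) F i).2 = \prod_(i <- r) (F i).2.
Proof. by elim: r => [|i r IHr]; rewrite ?big_nil// !big_cons wreathM2 IHr. Qed.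

Definition wreath_base (g : G) : wreath := (fun=> 0%R, g).

Lemma wreath_baseM : {morph wreath_base : g h / g * h}.
Proof. by move=> g h; congr pair; apply/funext => x /=; rewrite addr0. Qed.

Lemma wreath_base_prod (I : Type) (r : seq I) (F : I -> G) :
  \prod_(i <- r) wreath_base (F i) = wreath_base (\prod_(i <- r) F i).
Proof.
by elim: r => [|i r IHr]; rewrite ?big_nil// !big_cons IHr wreath_baseM.
Qed.

Lemma wreath_baseX g n : wreath_base g ^+ n = wreath_base (g ^+ n).
Proof. by elim: n => // n IHn; rewrite !expgS IHn wreath_baseM. Qed.

Variable H : set G.
Hypothesis nH : normal_subgroup H.

Definition wreath_invariant : set wreath :=
  [set a | forall x h, H h -> a.1 (x * h)%g = a.1 x].

Lemma subgroup_wreath_invariant : subgroup wreath_invariant.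
Proof.
have moveH a x h g : wreath_invariant a -> H h ->
    a.1 (x * h * g)%g = a.1 (x * g)%g.
  by move=> ia Hh; rewrite -mulgA (conjgC h g) mulgA ia//; exact: nH.2.
apply/subgroupP; split=> // a b ia ib x h Hh.
by rewrite !wreathM1 !wreathV1 ia// -!(mulgA _ a.2) moveH.
Qed.

Lemma wreath_base_commute c a : H c -> wreath_invariant a ->
  commute c a.2 -> commute (wreath_base c) a.
Proof.
move=> Hc ia ca; congr pair; last exact: ca.
by apply/funext => x; rewrite /= add0r addr0 ia.
Qed.

End Wreath.

(** On [N] the map [d] is additive, because its values are invariant under [H].
    If [N] were generated by a finite sequence [s], the functions [d n] with [n]
    in [N] would lie in the span [D] of those of [s], a finite set as [R] is
    finite. The conjugate of [a] by [g] has as its value the translate of [d a]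
    by [g], so there are finitely many translates; their supports cover [G],
    although each of them meets only finitely many cosets of [H]. *)
Lemma crossed_hom_not_finitely_generated (G : groupType) (N H : set G)
    (R : finNzRingType) (d : G -> G -> R) (a x0 : G) :
  normal_subgroup N -> normal_subgroup H -> N `<=` H -> ~ finite_index H ->
  (forall g h x, d (g * h) x = (d g x + d h (x * g)%g)%R) ->
  (forall g x h, H h -> d g (x * h) = d g x) ->
  N a -> coset_bounded H [set x | d a x != 0%R] -> d a x0 != 0%R ->
  ~ finitely_generated N.
Proof.
move=> nN nH NH infH dM dH Na ba da0 [A /finite_seqP[s ->] gs].
have d1 x : d 1 x = 0%R.
  by apply: (addrI (d 1 x)); rewrite -{2}[x]mulg1 -dM mulg1 addr0.
have dV g x : d g^-1 (x * g) = (- d g x)%R.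
  by apply: (addrI (d g x)); rewrite -dM mulgV d1 subrr.
pose D := (fun (r : {ffun seq_sub s -> R}) x => \sum_i r i * d (ssval i) x)%R
  @` setT.
have dN : N `<=` [set n | N n /\ D (d n)].
  rewrite -{1}gs; apply: generated_sub => [|n sn]; last first.
    split; first by rewrite -gs; exact: sub_generated.
    exists [ffun i => (ssval i == n)%:R%R] => //; apply/funext => x.
    rewrite (bigD1 (SeqSub sn))//= ffunE eqxx mul1r big1 ?addr0// => i.
    by rewrite ffunE -val_eqE => /= /negPf ->; rewrite mul0r.
  apply/subgroupP; split=> [|n m [Nn [r _ rn]] [Nm [t _ tm]]].
    split; first exact: subgroup1 nN.1.
    exists 0%R => //; apply/funext => x.
    by rewrite d1 big1// => i _; rewrite ffunE mul0r.
  split; first by have [_] := (subgroupP N).1 nN.1; apply.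
  exists (r - t)%R => //; apply/funext => x.
  have -> : d (n / m) x = (d n x - d m x)%R.
    rewrite dM (dH _ _ n); last exact: NH.
    by rewrite -dV (dH _ _ m)//; exact: NH.
  rewrite -rn -tm -sumrB; apply: eq_bigr => i _.
  by rewrite !ffunE mulrBl.
have dJ g x : d (g * a * g^-1) x = d a (x * g).
  rewrite !dM -addrA [(x * (g * a))%g]mulgA (dH g^-1); last exact: NH.
  by rewrite dV addrC subrK.
apply: infH; apply/finite_index_bounded; first exact: nH.1.
have /finite_seqP[l Dl] : finite_set D by exact/finite_image/finite_finset.
pose F (f : G -> R) := [set x | f x != 0%R /\ exists g, f = fun y => d a (y * g)].
apply: (@coset_bounded_cover _ _ l F) => [f fl|x _].
  have [[g fE]|nf] := pselect (exists g, f = fun y => d a (y * g)); last first.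
    by exists [::] => x [].
  have [t tP] := ba; exists [seq y * g^-1 | y <- t] => x [fx _].
  have [|y yt Hy] := tP (x * g).
    by rewrite /= -[d a _]/((fun y => d a (y * g)) x) -fE.
  exists (y * g^-1); first exact: map_f.
  rewrite invgM invgK -mulgA; apply/normal_subgroup_comm => //.
  by rewrite -mulgA.
pose g := x^-1 * x0.
have [_ Dg] : [set n | N n /\ D (d n)] (g * a * g^-1).
  by apply: dN; apply/normal_subgroup_conj.
exists (d (g * a * g^-1)); first by have: D (d (g * a * g^-1)) by []; rewrite Dl.
split; first by rewrite dJ mulVKg.
by exists g; apply/funext => y; exact: dJ.
Qed.

(** * Extensions by a cyclic quotient *)

Section CyclicExtension.
Variables (G : groupType) (H : set G) (s : G) (k : nat).
Hypotheses (nH : normal_subgroup H) (k_gt0 : (0 < k)%N) (Hsk : H (s ^+ k)).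

Let sH : subgroup H := nH.1.

(** The subgroup generated by [H] and [s]; since [s] has finite order modulo
    [H], nonnegative exponents suffice. *)
Definition cyclic_extension := [set x | exists n, H (s ^+ n * x)].

Lemma subgroup_cyclic_extension : subgroup cyclic_extension.
Proof.
have extM x y : cyclic_extension x -> cyclic_extension y ->
    cyclic_extension (x * y).
  move=> [n Hx] [m Hy]; exists (m + n)%N.
  have -> : s ^+ (m + n) * (x * y) = (s ^+ n * x) ^ (s ^+ m)^-1 * (s ^+ m * y).
    by rewrite conjgE invgK expgnDr -!mulgA mulKg.
  by apply: subgroupM => //; exact: nH.2.
have extV x : cyclic_extension x -> cyclic_extension x^-1.
  move=> [n /(subgroupV sH)]; rewrite invgM => /(normal_subgroup_comm _ _ nH) Hx.
  exists (n * k.-1)%N.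
  have -> : s ^+ (n * k.-1) = s ^+ k ^+ n * (s ^+ n)^-1.
    by rewrite -(expgnAC s n) expgnA -{2}(prednK k_gt0) expgSr mulgK.
  by rewrite -mulgA; apply: subgroupM => //; exact: subgroupX.
apply/subgroupP; split=> [|x y Sx Sy].
  by exists 0%N; rewrite mulg1; exact: subgroup1.
by apply: extM => //; exact: extV.
Qed.

Lemma sub_cyclic_extension : H `<=` cyclic_extension.
Proof. by move=> x Hx; exists 0%N; rewrite mul1g. Qed.

Lemma cyclic_extension_base : cyclic_extension s.
Proof. by exists k.-1; rewrite -expgSr prednK. Qed.

Lemma coset_bounded_cyclic_extension : coset_bounded H cyclic_extension.
Proof.
exists [seq (s ^+ i)^-1 | i <- iota 0 k] => x [n Hx].
exists (s ^+ (n %% k))^-1; first by apply: map_f; rewrite mem_iota ltn_mod.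
have Hq : H (s ^+ (n %/ k * k)) by rewrite mulnC expgnA; exact: subgroupX.
by rewrite invgK -(subgroup_mull _ sH Hq) mulgA -expgnDr -divn_eq.
Qed.

(** The cycle of [x] modulo [H] under right translation by [s] may have a proper
    divisor of [k] as its period, so one passage through [H] may count several
    times. *)
Definition cycle_count x := (\sum_(l < k) `[< H (x * s ^+ l)%g >])%N.

Lemma cycle_count_in x : H x -> cycle_count x = cycle_count 1.
Proof.
move=> Hx; apply: eq_bigr => l _; congr nat_of_bool.
by apply: asbool_equiv_eq; rewrite mul1g subgroup_mull.
Qed.

Lemma cycle_count_shift x : cycle_count (x * s) = cycle_count x.
Proof.
rewrite /cycle_count; case: k Hsk => [|n] Hn; first by rewrite !big_ord0.
rewrite big_ord_recr big_ord_recl /= addnC; congr (_ + _)%N.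
  congr nat_of_bool; apply: asbool_equiv_eq.
  by rewrite -mulgA -expgS mulg1 subgroup_mulr.
by apply: eq_bigr => l _; rewrite -mulgA -expgS.
Qed.

Lemma cycle_count_eq0 x :
  (forall l, ~ H (x * s ^+ l)) -> cycle_count x = 0%N.
Proof.
by move=> nHx; rewrite /cycle_count big1// => l _; rewrite asboolF.
Qed.

(** Cycles modulo [H] under right translation by [s] either miss the coset [H]
    or are the cycle of [1]. *)
Lemma cycle_countP x : cycle_count x = 0%N \/ cycle_count x = cycle_count 1.
Proof.
have [[l Hx]|nHx] := pselect (exists l, H (x * s ^+ l)); last first.
  by left; apply: cycle_count_eq0 => l Hx; apply: nHx; exists l.
right; rewrite -(cycle_count_in Hx).
elim: l {Hx} => [|l IHl]; first by rewrite mulg1.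
by rewrite expgSr mulgA cycle_count_shift.
Qed.

Lemma cycle_count_gt0 : (0 < cycle_count 1)%N.
Proof.
rewrite /cycle_count; case: k k_gt0 => // n _.
rewrite big_ord_recl asboolT//= mul1g; exact: subgroup1.
Qed.

End CyclicExtension.

(** * Presented groups and products along a cycle *)

Lemma word_val_positive (I : choiceType) (G : groupType) (f : I -> G) (r : seq I) :
  word_val f [seq (i, false) | i <- r] = \prod_(i <- r) f i.
Proof. by rewrite /word_val big_map. Qed.

Lemma pres_gen_generates (I : choiceType) (rels : set (word I * word I)) :
  generated (range (pres_gen rels)) = [set: presented rels].
Proof.
apply/seteqP; split=> // x _; rewrite -(pres_repr x) pres_classE /word_val.
have sg := subgroup_generated (range (pres_gen rels)).
have gen i : generated (range (pres_gen rels)) (pres_gen rels i).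
  by apply: sub_generated; exists i.
elim: (repr x) => [|[i b] u IHu]; first by rewrite big_nil; exact: subgroup1.
rewrite big_cons; apply: (subgroupM sg) => //; case: b => //=.
exact: (subgroupV sg).
Qed.

Lemma prod_rot (I : Type) (G : groupType) (f : I -> G) (r : seq I) n :
  (forall i, commute (\prod_(j <- r) f j) (f i)) ->
  \prod_(i <- rot n r) f i = \prod_(i <- r) f i.
Proof.
move=> fC; rewrite /rot big_cat /=.
apply: (mulgI (\prod_(i <- take n r) f i)).
rewrite mulgA -big_cat cat_take_drop.
exact: commute_prod.
Qed.

Lemma commute_prod_rot (I : eqType) (G : groupType) (f : I -> G) (r : seq I) j :
  (forall n, (n < size r)%N -> \prod_(i <- rot n r) f i = \prod_(i <- r) f i) ->
  j \in r -> commute (\prod_(i <- r) f i) (f j).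
Proof.
move=> rotr jr; have jlt : (index j r < size r)%N by rewrite index_mem.
have [t rE] : exists t, rot (index j r) r = j :: t by rewrite rot_index//; eexists.
have prodE : \prod_(i <- r) f i = f j * \prod_(i <- t) f i.
  by rewrite -(rotr _ jlt) rE big_cons.
have : \prod_(i <- rot (index j r).+1 r) f i = \prod_(i <- r) f i.
  have [/rotr//|le] := ltnP (index j r).+1 (size r).
  by rewrite rot_oversize.
rewrite rotS// rE rot1_cons big_rcons /= => prodE'.
by rewrite /commute {1}prodE -mulgA prodE'.
Qed.

(** * The parent group and its crossed homomorphisms *)

Section ParentJ.
Variables (p : nat) (K : p.-tuple (option nat)).
Local Notation G := (parent_J K).
Local Notation s := (J_gen K).

Definition J_prod : G := \prod_(i <- enum 'I_p) s i.

Lemma J_gen_generates : generated (range s) = [set: G].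
Proof. exact: pres_gen_generates. Qed.

Lemma J_prod_commute x : commute J_prod x.
Proof.
have rotE n : (n < size (enum 'I_p))%N ->
    \prod_(i <- rot n (enum 'I_p)) s i = J_prod.
  rewrite size_enum_ord => np.
  rewrite -[LHS]word_val_positive map_rot -[RHS]word_val_positive -!pres_classE.
  apply/esym/pres_classP/word_eq_rel; left.
  by exists (Ordinal np).
have : [set: G] x by [].
rewrite -J_gen_generates; move: x; apply: generated_sub => [|_ [i _ <-]].
  apply/subgroupP; split=> [|x y cx cy]; first exact: commute1.
  by apply: commuteM => //; exact: commuteV.
by apply: commute_prod_rot => //; rewrite mem_enum.
Qed.

Lemma J_genX i k : tnth K i = Some k -> s i ^+ k = 1.
Proof.
move=> Ki; have kE : pres_class (J_rels K) (nseq k (i, false)) = 1.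
  by apply/pres_classP/word_eq_rel; right; exists i, k.
by rewrite -kE pres_classE /word_val big_nseq iter_mulg_1.
Qed.

(** The cyclic relations say precisely that the product of the generators
    commutes with each of them. *)
Lemma J_hom (E : groupType) (f : 'I_p -> E) :
  (forall i, commute (\prod_(j <- enum 'I_p) f j) (f i)) ->
  (forall i k, tnth K i = Some k -> f i ^+ k = 1) ->
  exists h : G -> E, {morph h : x y / x * y} /\ forall i, h (s i) = f i.
Proof.
move=> fC fX; have [|h [hP _]] := @presentedP _ (J_rels K) E f; last by exists h.
move=> u v [[i [-> ->]]|[i [k [Ki [-> ->]]]]].
  by rewrite -map_rot !word_val_positive prod_rot.
by rewrite /word_val big_nil big_nseq -[RHS](fX i k Ki); exact: iter_mulg_1.
Qed.

Section CrossedHom.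
Variables (H : set G) (V : zmodType) (w : G -> V).
Variables (i0 i1 : 'I_p) (r1 r2 : seq 'I_p) (n0 : nat).
Hypotheses (nH : normal_subgroup H) (Hc : H J_prod).
Hypothesis wH : forall x h, H h -> w (x * h) = w x.
Hypothesis rotE : rot n0 (enum 'I_p) = i0 :: r1 ++ i1 :: r2.

Let u := s i0 * \prod_(i <- r1) s i.
Hypothesis w_norm : forall k x, tnth K i0 = Some k ->
  (\sum_(l < k) (w (x * s i0 ^+ l * u * s i1)%g - w (x * s i0 ^+ l * u)%g) = 0)%R.

(** The morphism to the wreath product sends [s_i1] to its conjugate by [w], the
    other [s_i] with [i] different from [i0] to themselves, and [s_i0] to what
    is needed for the product, read cyclically from [i0], to remain equal to
    [J_prod]. Hypothesis [w_norm] expresses that the image of [s_i0] still has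
    order dividing [k_i0]. *)
Lemma J_crossed_hom : exists d : G -> G -> V,
  [/\ forall g h x, d (g * h) x = (d g x + d h (x * g)%g)%R,
      forall g x h, H h -> d g (x * h) = d g x &
      forall x, d (s i0) x = (w (x * u * s i1)%g - w (x * u)%g)%R].
Proof.
have : uniq (i0 :: r1 ++ i1 :: r2) by rewrite -rotE rot_uniq enum_uniq.
rewrite cons_uniq cat_uniq /= mem_cat inE !negb_or => /andP[].
move=> /and3P[i0r1 i01 i0r2] /and4P[_ /andP[i1r1 _] i1r2 _].
pose b : wreath G V := (w, 1).
pose c : wreath G V := wreath_base V J_prod.
pose f i : wreath G V :=
  if i == i1 then b * wreath_base V (s i) * b^-1 else wreath_base V (s i).
pose rest := \prod_(i <- r1 ++ i1 :: r2) f i.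
pose sigma i := if i == i0 then c * rest^-1 else f i.
have f_out (r : seq 'I_p) : i1 \notin r ->
    \prod_(i <- r) f i = wreath_base V (\prod_(i <- r) s i).
  move=> i1r; rewrite -wreath_base_prod; apply: eq_big_seq => i ir.
  by rewrite /f; case: eqP ir => // ->; rewrite (negPf i1r).
have restE : rest = wreath_base V (\prod_(i <- r1) s i) *
    (b * wreath_base V (s i1) * b^-1) * wreath_base V (\prod_(i <- r2) s i).
  by rewrite /rest big_cat big_cons /= !f_out// {1}/f eqxx mulgA.
have f2 i : (f i).2 = s i.
  by rewrite /f; case: ifP => // _; rewrite /= invg1 mulg1 mul1g.
have prod_sigma : \prod_(i <- i0 :: r1 ++ i1 :: r2) sigma i = c.
  rewrite big_cons {1}/sigma eqxx.
  suff -> : \prod_(i <- r1 ++ i1 :: r2) sigma i = rest by rewrite mulgVK.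
  apply: eq_big_seq => i; rewrite /sigma; case: eqP => // ->.
  by rewrite mem_cat inE (negPf i0r1) (negPf i01) (negPf i0r2).
have prod_s : J_prod = s i0 * \prod_(i <- r1 ++ i1 :: r2) s i.
  rewrite -[LHS](@prod_rot _ _ s _ n0) => [|i]; last exact: J_prod_commute.
  by rewrite rotE big_cons.
have sigma2 i : (sigma i).2 = s i.
  rewrite /sigma; case: eqP => [->|//]; rewrite wreathM2 wreathV2 wreath_prod2.
  by rewrite (eq_bigr _ (fun i _ => f2 i)) -[c.2]/J_prod prod_s mulgK.
have sW := subgroup_wreath_invariant V nH.
have sigma_inv i : wreath_invariant H (sigma i).
  have inv_b : wreath_invariant H b by [].
  have inv_f j : wreath_invariant H (f j).
    rewrite /f; case: ifP => // _.
    apply: (subgroupM sW); last exact: (subgroupV sW).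
    exact: (subgroupM sW).
  rewrite /sigma; case: ifP => // _.
  apply: (subgroupM sW) => //; apply: (subgroupV sW); rewrite restE.
  by do !apply: (subgroupM sW) => //; exact: (subgroupV sW).
have sigma1 x : (sigma i0).1 x = (w (x * u * s i1)%g - w (x * u)%g)%R.
  rewrite /sigma eqxx wreathM1 wreathV1 add0r wreath_prod2.
  rewrite (eq_bigr _ (fun i _ => f2 i)) -mulgA -[c.2]/J_prod prod_s mulgK restE.
  rewrite !wreathM1 !wreathM2 wreathV1 /= add0r !addr0 invg1 !mul1g !mulg1 opprB.
  by rewrite -(mulgA x).
have cC i : commute c (sigma i).
  apply: (wreath_base_commute Hc) => //; exact: J_prod_commute.
have sigma_prod : \prod_(i <- enum 'I_p) sigma i = c.
  rewrite -[enum 'I_p](rotK n0) /rotr prod_rot rotE prod_sigma//.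
have [||h [hM hs]] := @J_hom _ sigma.
- by move=> i; rewrite sigma_prod.
- move=> i k Ki; rewrite /sigma; case: eqP => [ii0|_].
    have -> : c * rest^-1 = sigma i0 by rewrite /sigma eqxx.
    apply: wreath_eq1 => [x|]; last by rewrite wreathX2 sigma2 -ii0 (J_genX Ki).
    rewrite wreathX1 sigma2 -[RHS](w_norm x (etrans (congr1 _ (esym ii0)) Ki)).
    by apply: eq_bigr.
  have baseX : wreath_base V (s i) ^+ k = 1 by rewrite wreath_baseX (J_genX Ki).
  rewrite /f; case: ifP => // _; rewrite -{1}[b]invgK -mulgA -conjgE -conjXg.
  by rewrite baseX conj1g.
have in_all (P : set G) : subgroup P -> (forall i, P (s i)) -> forall g, P g.
  move=> sP Ps g; have : [set: G] g by [].
  by rewrite -J_gen_generates; apply: generated_sub => // _ [i _ <-].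
have h1 : h 1 = 1 by apply: (mulIg (h 1)); rewrite -hM !mul1g.
have hV g : h g^-1 = (h g)^-1 by apply/esym/mulg1_eq; rewrite -hM mulgV h1.
have h2 g : (h g).2 = g.
  apply: (in_all [set g | (h g).2 = g]) => [|i /=]; last by rewrite hs.
  apply/subgroupP; split=> [|x y /= hx hy] /=; first by rewrite h1.
  by rewrite hM hV wreathM2 wreathV2 hx hy.
have h_inv g : wreath_invariant H (h g).
  apply: (in_all [set g | wreath_invariant H (h g)]) => [|i /=]; last by rewrite hs.
  apply/subgroupP; split=> [|x y /= hx hy] /=; first by rewrite h1.
  rewrite hM hV; apply: (subgroupM sW) => //; exact: (subgroupV sW).
exists (fun g => (h g).1); split=> [g g' x|g x a Ha|x].
- by rewrite hM wreathM1 h2.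
- exact: h_inv.
- by rewrite hs.
Qed.
End CrossedHom.
End ParentJ.

(** * Infinite index excludes finite generation *)

Lemma crossed_homX (G : groupType) (V : zmodType) (d : G -> G -> V) :
  (forall g h x, d (g * h) x = (d g x + d h (x * g)%g)%R) ->
  forall g n x, d (g ^+ n) x = (\sum_(l < n) d g (x * g ^+ l)%g)%R.
Proof.
move=> dM g; elim=> [|n IHn] x.
  by rewrite big_ord0; apply: (addrI (d 1 x)); rewrite -{2}[x]mulg1 -dM mulg1 addr0.
by rewrite expgSr dM IHn big_ord_recr.
Qed.

Lemma sum_periodic (V : zmodType) (F : nat -> V) q k :
  (forall l, F (l + k)%N = F l) ->
  (\sum_(l < q * k) F l = (\sum_(l < k) F l) *+ q)%R.
Proof.
move=> Fk; elim: q => [|q IHq]; first by rewrite mul0n big_ord0.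
rewrite mulSn addnC big_split_ord /= IHq mulrSr; congr (_ + _)%R.
apply: eq_bigr => l _ /=; rewrite addnC.
elim: q {IHq} => [|q IHq]; first by rewrite mul0n addn0.
by rewrite mulSn addnCA addnC Fk.
Qed.

Lemma first_split (I : eqType) (P : set I) (r : seq I) :
  (exists2 i, i \in r & ~ P i) ->
  exists r1 i r2, [/\ r = r1 ++ i :: r2, {in r1, forall j, P j} & ~ P i].
Proof.
elim: r => [|j r IHr] [i]; rewrite ?in_nil// => ir nPi.
have [Pj|nPj] := pselect (P j); last by exists [::], j, r.
have [|r1 [i' [r2 [-> Pr1 nPi']]]] := IHr.
  by exists i => //; move: ir; rewrite inE => /predU1P[ij|//]; rewrite ij in nPi.
exists (j :: r1), i', r2; split=> // l; rewrite inE => /predU1P[->//|].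
exact: Pr1.
Qed.

Section InfiniteIndex.
Variables (p : nat) (K : p.-tuple (option nat)) (N H : set (parent_J K)).
Variables (i0 : 'I_p) (k : nat).
Hypotheses (nN : normal_subgroup N) (nH : normal_subgroup H) (NH : N `<=` H).
Hypotheses (Hc : H (J_prod K)) (infH : ~ finite_index H).
Hypothesis k_gt0 : (0 < k)%N.
Hypothesis k_dvd : forall m, tnth K i0 = Some m -> (0 < m)%N /\ (k %| m)%N.
Local Notation s := (J_gen K i0).
Hypotheses (Nsk : N (s ^+ k)) (sk_neq1 : s ^+ k <> 1).

(** [S] is [H <s>] for [s] the generator of index [i0], and [i] is the first
    index after [i0], in the cyclic order, whose generator lies outside [S]:
    then [u], the product of the generators from [i0] up to [i] excluded, lies
    in [S], and [u * s_i * u^-1] does not. This puts the cosets of [u^-1] and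
    [(u * s_i)^-1] on different [s]-cycles, so that their contributions to
    [d (s ^+ k)] do not cancel at [u^-1]. *)
Lemma J_not_finitely_generated : ~ finitely_generated N.
Proof.
have sH := nH.1; have Hsk := NH Nsk.
pose S := cyclic_extension H s.
have sS : subgroup S := subgroup_cyclic_extension nH k_gt0 Hsk.
have Ss : S s := cyclic_extension_base k_gt0 Hsk.
have HS : H `<=` S := @sub_cyclic_extension _ H s.
have [i1 nSi1] : exists i, ~ S (J_gen K i).
  apply: contrapT => allS; apply: infH; apply/finite_index_bounded => //.
  have [t tP] := coset_bounded_cyclic_extension nH k_gt0 Hsk.
  exists t => x _; apply: tP; have : [set: parent_J K] x by [].
  rewrite -J_gen_generates; apply: generated_sub => // _ [i _ <-].
  by apply: contrapT => nSi; apply: allS; exists i.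
have [r rE] : exists r, rot (index i0 (enum 'I_p)) (enum 'I_p) = i0 :: r.
  by rewrite rot_index ?mem_enum//; eexists.
have [|r1 [i [r2 [rE' Sr1 nSi]]]] := @first_split _ [set i | S (J_gen K i)] r.
  exists i1 => //; have : i1 \in i0 :: r by rewrite -rE mem_rot mem_enum.
  by rewrite inE => /predU1P[ii0|//]; rewrite ii0 in nSi1.
pose u := s * \prod_(j <- r1) J_gen K j.
have Su : S u.
  apply: subgroupM => //; elim: r1 Sr1 {rE' u} => [|j r1 IHr1] Sr1.
    by rewrite big_nil; exact: subgroup1.
  rewrite big_cons; apply: subgroupM => //; first by apply: Sr1; rewrite mem_head.
  by apply: IHr1 => l lr1; apply: Sr1; rewrite inE lr1 orbT.
pose e := cycle_count H s k 1.
have e_gt0 : (0 < e)%N by exact: cycle_count_gt0.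
have [q q_gt1 qP] : exists2 q, (1 < q)%N &
    forall m, tnth K i0 = Some m -> m = (q * k)%N.
  case Ki0: (tnth K i0) => [m|]; last first.
    (* a generator of infinite order imposes no condition on [q] *)
    by exists 2.
  have [m_gt0 /dvdnP[q mE]] := k_dvd Ki0; exists q => [|_ [<-]//].
  case: q mE => [|[|q]] mE //; first by rewrite mE in m_gt0.
  by case: sk_neq1; rewrite -[k]mul1n -mE (J_genX Ki0).
(* [s ^+ (q * k)] is sent to a multiple of [q * e], which must vanish, and
   [s ^+ k] to [- e] at [u^-1], which must not. *)
pose M := (q * e)%N; pose R : finNzRingType := 'Z_M.
have M_gt1 : (1 < M)%N by rewrite (leq_trans q_gt1)// leq_pmulr.
have natR0 n : ((n%:R)%R == 0%R :> R) = (M %| n)%N.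
  by rewrite /R -val_eqE /= val_Zp_nat.
pose w x : R := ((`[< H x >] : nat)%:R)%R.
have wH x h : H h -> w (x * h) = w x.
  by move=> Hh; rewrite /w (asbool_equiv_eq (subgroup_mulr _ sH Hh)).
have wC x y : w (x * y) = w (y * x).
  by rewrite /w (asbool_equiv_eq (normal_subgroup_comm x y nH)).
have w_count z x :
    (\sum_(l < k) w (x * s ^+ l * z)%g = (cycle_count H s k (z * x)%g)%:R)%R.
  rewrite natr_sum; apply: eq_bigr => l _.
  by rewrite wC mulgA.
have count_M x : ((cycle_count H s k x)%:R *+ q = 0 :> R)%R.
  rewrite -mulrnA; apply/eqP; rewrite natR0 /M mulnC.
  by have [->|->] := cycle_countP nH Hsk x; rewrite ?dvdn0.
pose v x : R := (w (x * u * J_gen K i)%g - w (x * u)%g)%R.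
have v_sum x : (\sum_(l < k) v (x * s ^+ l)%g =
    (cycle_count H s k (u * J_gen K i * x)%g)%:R - (cycle_count H s k (u * x)%g)%:R)%R.
  by rewrite sumrB; congr (_ - _)%R; rewrite -w_count; apply: eq_bigr => l _;
    rewrite ?mulgA.
have v_per x l : v (x * s ^+ (l + k)) = v (x * s ^+ l).
  rewrite /v; have wsk z : w (x * s ^+ (l + k) * z) = w (x * s ^+ l * z).
    by rewrite [LHS]wC [RHS]wC expgnDr !mulgA wH.
  by rewrite -!(mulgA _ u) !wsk.
have [|d [dM dH ds]] := J_crossed_hom nH Hc wH (etrans rE (congr1 (cons i0) rE')).
  move=> m x /qP ->.
  rewrite (sum_periodic (F := fun l => v (x * s ^+ l))) => [|l]; last exact: v_per.
  by rewrite v_sum mulrnBl !count_M subrr.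
have dsk x : d (s ^+ k) x =
    ((cycle_count H s k (u * J_gen K i * x)%g)%:R - (cycle_count H s k (u * x)%g)%:R)%R.
  by rewrite crossed_homX// -v_sum; apply: eq_bigr => l _; rewrite ds.
apply: (@crossed_hom_not_finitely_generated _ N H R d (s ^+ k) u^-1) => //.
  pose reps z := [seq (s ^+ l * z)^-1 | l <- iota 0 k].
  exists (reps (u * J_gen K i) ++ reps u) => x /=.
  rewrite dsk; apply: contraNP => noy; have noH z : z = u * J_gen K i \/ z = u ->
      forall l, ~ H (z * x * s ^+ l).
    move=> zu l Hl; apply: noy; exists (s ^+ (l %% k) * z)^-1.
      by rewrite mem_cat; case: zu => ->; apply/orP; [left | right];
        apply: map_f; rewrite mem_iota ltn_mod.
    have Hq : H (s ^+ (l %/ k * k)) by rewrite mulnC expgnA; exact: subgroupX.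
    rewrite invgK -(subgroup_mull _ sH Hq) !mulgA -expgnDr -divn_eq -mulgA.
    exact/normal_subgroup_comm.
  by rewrite !cycle_count_eq0 ?subrr//; apply: noH; [right | left].
rewrite dsk mulgV cycle_count_eq0 => [|l Hl]; last first.
  (* otherwise [u * J_gen K i * u^-1 * s ^+ l] lies in [H] *)
  apply: nSi; apply/(subgroup_mull _ sS Su)/(subgroup_mulr _ sS (subgroupV sS Su)).
  apply/(subgroup_mulr _ sS (subgroupX l sS Ss)); exact: HS.
rewrite sub0r oppr_eq0 natR0 gtnNdvd//.
by rewrite -/e /M -{1}[e]mul1n ltn_pmul2r.
Qed.
End InfiniteIndex.

(** * Finiteness, finite generation and index *)

Lemma finite_subgroup_finitely_generated (G : groupType) (H : set G) :
  subgroup H -> finite_set H -> finitely_generated H.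
Proof. by move=> sH fH; exists H => //; exact: smallest_id. Qed.

Lemma finite_of_finite_index (G : groupType) (H : set G) :
  subgroup H -> finite_index H -> finite_set H -> finite_set [set: G].
Proof.
move=> sH /(finite_index_bounded sH)[t tP] fH.
have ftH := finite_setX (finite_seq t) fH.
apply: sub_finite_set (finite_image (fun a => a.1 * a.2) ftH).
by move=> x _; have [//|y yt Hy] := tP x; exists (y, y^-1 * x); rewrite //= mulVKg.
Qed.

Lemma generalized_J_not_finitely_generated (p : nat)
    (K : p.-tuple (option nat)) (K' : p.-tuple nat) :
  (forall (i : 'I_p) (k : nat), tnth K i = Some k -> (2 <= k)%N) ->
  (forall i : 'I_p, (0 < tnth K' i)%N) ->
  (forall i : 'I_p, divides_ext (tnth K' i) (tnth K i)) ->
  generalized_J K K' <> [set 1] -> ~ finite_index (generalized_J K K') ->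
  ~ finitely_generated (generalized_J K K').
Proof.
move=> K_ge2 K'_gt0 K'_dvd N_neq1 infN.
have nN : normal_subgroup (generalized_J K K') := normal_normal_closure _.
have NsX i : generalized_J K K' (J_gen K i ^+ tnth K' i).
  by apply: sub_gen_smallest; exists i.
have [i0 si0] : exists i, J_gen K i ^+ tnth K' i <> 1.
  apply: contrapT => all1; apply: N_neq1; apply/seteqP; split.
    apply: smallest_sub => [|_ [i _ <-]].
      split=> [|_ y ->]; last by rewrite /= conj1g.
      by apply/subgroupP; split=> // _ _ -> ->; rewrite /= divg1.
    by apply: contrapT => si; apply: all1; exists i.
  by move=> _ ->; exact: subgroup1 nN.1.
have cC := @J_prod_commute p K.
have nH := normal_central_product nN cC.
apply: (J_not_finitely_generated nN nH _ _ _ (K'_gt0 i0) _ (NsX i0) si0).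
- exact: sub_central_product.
- exact: central_product_base.
- move=> fH; apply: infN.
  apply: (central_product_finite_index nN cC (J_gen_generates K)) fH.
  by move=> _ [i _ <-]; exists (tnth K' i).
- move=> m Ki0; have := K'_dvd i0; rewrite Ki0 => /= ->.
  by split=> //; exact: leq_trans (K_ge2 _ _ Ki0).
Qed.

Theorem theorem1p3 (p : nat) (K : p.-tuple (option nat)) (K' : p.-tuple nat)
    (hp : (1 <= p)%N)
    (hK : forall (i : 'I_p) (k : nat), tnth K i = Some k -> (2 <= k)%N)
    (hK' : forall i : 'I_p, (0 < tnth K' i)%N)
    (hdvd : forall i : 'I_p, divides_ext (tnth K' i) (tnth K i))
    (hJ : generalized_J K K' <> [set 1%g]) :
  let case1 := finite_set [set: parent_J K] in
  let case2 := infinite_set [set: parent_J K] /\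
               finite_index (generalized_J K K') in
  let case3 := ~ finite_index (generalized_J K K') in
  exactly_one_of_three case1 case2 case3 /\
  (finite_set (generalized_J K K') <-> case1) /\
  (infinite_set (generalized_J K K') /\
     finitely_generated (generalized_J K K') <-> case2) /\
  (~ finitely_generated (generalized_J K K') <-> case3).
Proof.
have sN : subgroup (generalized_J K K') := (normal_normal_closure _).1.
have gen_fin : finite_set (range (J_gen K)) by exact/finite_image/finite_finset.
have fi_fg := schreier gen_fin (J_gen_generates K) sN.
have fg_fi : finitely_generated (generalized_J K K') ->
    finite_index (generalized_J K K').
  move=> fg; apply: contrapT => nfi; move: fg.
  exact: generalized_J_not_finitely_generated.
have fG_fi : finite_set [set: parent_J K] -> finite_index (generalized_J K K').
  exact: finite_image.
have fN_fG : finite_set (generalized_J K K') -> finite_set [set: parent_J K].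
  move=> fN; apply: finite_of_finite_index (fN) => //.
  exact/fg_fi/finite_subgroup_finitely_generated.
have fG_fN : finite_set [set: parent_J K] -> finite_set (generalized_J K K').
  exact: sub_finite_set.
move=> case1 case2 case3; rewrite /case1 /case2 /case3 /exactly_one_of_three.
have [fG|iG] := pselect (finite_set [set: parent_J K]);
  have [fi|nfi] := pselect (finite_index (generalized_J K K')); tauto.
Qed.
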